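(* For every $l\ge1$ there exists a regular Toeplitz sequence $x\in\{0,1\}^{\mathbb{Z}}$ such that a P$_l$NT does not hold for the subshift $(X_x,S)$. In fact, $x$ can be chosen with a periodic structure $(n_t)_{t\ge1}$ such that $$\lim_{t\to\infty}\frac{1}{\pi_l(n_t)}\sum_{q\in\mathbb{P}_l^{n_t}}F(S^{q}x)\quad\text{does not exist},$$ where $F(y)=(-1)^{y(0)}$.
   Context: A natural number is an $l$-almost prime if it is a product of $l$ primes (not necessarily distinct). $\mathbb{P}_l^N$ is the set of $l$-almost primes $\le N$ and $\pi_l(N)=\#\mathbb{P}_l^N$. A topological dynamical system $(X,T)$ satisfies a P$_l$NT if $\lim_{N\to\infty}\frac{1}{\pi_l(N)}\sum_{n\in\mathbb{P}_l^N}f(T^ny)$ exists for every $y\in X$ and every $f\in C(X)$. $S$ is the left shift on $\{0,1\}^{\mathbb{Z}}$. A sequence $x$ is Toeplitz if for every $a\in\mathbb{Z}$ there is $\ell\ge1$ with $x(a)=x(a+k\ell)$ for all $k\in\mathbb{Z}$; $X_x$ is the orbit closure of $x$ under $S$. Let $\mathrm{Per}_n(x)=\{a\in\mathbb{Z}:x(a)=x(a+kn)\text{ for all }k\in\mathbb{Z}\}$. A periodic structure of $x$ is a sequence $(n_t)$ with $n_t\mid n_{t+1}$ and $\bigcup_t\mathrm{Per}_{n_t}(x)=\mathbb{Z}$; $x$ is regular if the density of $\mathrm{Per}_{n_t}(x)$ tends to $1$ as $t\to\infty$. *)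

(* Defs.v *)
From HB Require Import structures.
From mathcomp Require Import all_boot all_order all_algebra.
From mathcomp Require Import all_classical all_reals all_analysis.

Set Implicit Arguments.
Unset Strict Implicit.
Unset Printing Implicit Defensive.

Import Order.TTheory GRing.Theory Num.Theory.
Import numFieldNormedType.Exports.

Local Open Scope classical_set_scope.
Local Open Scope ring_scope.

Definition almost_prime (l n : nat) : bool :=
  `[< exists s : seq nat,
        [/\ size s = l, all prime s & n = (\prod_(p <- s) p)%N] >].

Definition almost_primes (l N : nat) : seq nat :=
  [seq n <- iota 0 N.+1 | almost_prime l n].

Definition almost_prime_pi (l N : nat) : nat := size (almost_primes l N).

Definition almost_prime_avg (R : realType) (l N : nat) (u : nat -> R) : R :=
  (almost_prime_pi l N)%:R^-1 * \sum_(q <- almost_primes l N) u q.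

(* The system is (X, T) with X a T-invariant subset of an ambient space E
   carrying the subspace topology, so that the elements of C(X) are the
   f : E -> R continuous within X, considered on X only. *)
Definition almost_PNT (R : realType) (l : nat) (E : topologicalType)
    (X : set E) (T : E -> E) : Prop :=
  forall (y : E) (f : E -> R), X y -> {within X, continuous f} ->
    cvgn (fun N => almost_prime_avg l N (fun q => f (iter q T y))).

Definition full_shift : Type := prod_topology (fun _ : int => bool).

HB.instance Definition _ := Pointed.on full_shift.
HB.instance Definition _ := Nbhs.on full_shift.
HB.instance Definition _ := Topological.on full_shift.
HB.instance Definition _ := Uniform.on full_shift.

(* The k-th power of the left shift, for k in Z. *)
Definition shiftz (k : int) (y : full_shift) : full_shift :=
  fun a => y (a + k).

Definition left_shift : full_shift -> full_shift := shiftz 1.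

Definition orbit_closure (x : full_shift) : set full_shift :=
  closure (range (shiftz ^~ x)).

Definition toeplitz (x : full_shift) : Prop :=
  forall a : int, exists2 p : nat, (0 < p)%N &
    forall k : int, x a = x (a + k * p%:Z).

Definition Per (n : nat) (x : full_shift) : set int :=
  [set a | forall k : int, x a = x (a + k * n%:Z)].

(* Positivity excludes n = 0, for which Per 0 x is all of Z. *)
Definition periodic_structure (x : full_shift) (n : nat -> nat) : Prop :=
  [/\ forall t, (0 < n t)%N,
      forall t, (n t %| n t.+1)%N &
      \bigcup_t Per (n t) x = [set: int]].

(* Natural density along the windows [-N, N]; the limit exists for the periodic
   sets Per n x with n > 0. *)
Definition natural_density (R : realType) (A : set int) : R :=
  limn (fun N : nat =>
    (\sum_(i < N.*2.+1) \1_A (i%:Z - N%:Z)) / (N.*2.+1)%:R : R).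

(* Whether the densities tend to 1 does not depend on the choice of the
   periodic structure. *)
Definition regular_toeplitz (R : realType) (x : full_shift) : Prop :=
  exists2 n : nat -> nat, periodic_structure x n &
    (natural_density R (Per (n t) x)) @[t --> \oo] --> (1 : R).

Definition signF (R : realType) (y : full_shift) : R := (-1) ^+ (y 0).

(* Main.v *)
Require Import Defs.
From mathcomp Require Import all_boot all_order all_algebra.
From mathcomp Require Import all_classical all_reals all_analysis.
From mathcomp Require cyclic.
From mathcomp Require Import zify ring lra.
Import Order.TTheory GRing.Theory Num.Theory.
Import numFieldNormedType.Exports.

Set Implicit Arguments.
Unset Strict Implicit.
Unset Printing Implicit Defensive.

(* The value of x at a is the parity of the first stage at which a is
   prescribed. Stage t prescribes the classes modulo n_{t+1} of the integers of
   [-n_t, n_t], and those of the integers sharing with n_{t+1} a divisor with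
   l + 1 prime factors; the latter have density tending to 1 and contain no
   l-almost prime. So the average at n_t is close to (-1)^t as soon as, for each
   s < t, few l-almost primes up to n_t lie in the finitely many window classes
   of stage s. Dirichlet's theorem is not needed for this: it suffices that a
   class modulo 2^k carries a proportion of the almost primes that is eventually
   smaller than any given constant when k is large. For primes this follows from
   Chebyshev's method, applied to the product of (2^k j + a) over j < n divided
   by the odd part of n!, which yields O(k N / (2^k log N)) primes in the class;
   for almost primes q = r p, one sums over r and compares with the lower bound
   of Chebyshev, the sums of N / r being the same on both sides. *)

(** * Chebyshev's lower bound *)

Lemma sum_leq_minn m t : \sum_(1 <= k < m.+1) (k <= t : nat) = minn m t.
Proof.
elim: m => [|m IHm]; first by rewrite big_geq // min0n.
by rewrite big_nat_recr //= IHm; lia.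
Qed.

(** Legendre's formula with a longer range, whose extra terms vanish, so that [n] and [n.*2] can
    share one range. *)
Lemma logn_fact_wide p n m : prime p -> n <= m ->
  logn p n`! = \sum_(1 <= k < m.+1) n %/ p ^ k.
Proof.
move=> pp lenm; have len : n.+1 <= m.+1 by [].
rewrite logn_fact // (big_cat_nat (ltn0Sn n) len) /=.
rewrite [X in _ = (_ + X)%N]big_nat_cond [X in _ = (_ + X)%N]big1 ?addn0 // => k.
rewrite andbT => /andP[ltnk _]; apply: divn_small.
by apply: leq_trans ltnk _; exact/ltnW/ltn_expl/prime_gt1.
Qed.

(** By Legendre, the exponent is the sum over [k] of [2n %/ p ^ k - 2 (n %/ p ^ k)]; each term is 0
    or 1, and it is 0 once [p ^ k] exceeds [2n]. *)
Lemma expn_logn_bin p n : prime p -> 0 < n -> p ^ logn p 'C(n.*2, n) <= n.*2.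
Proof.
move=> pp n0; set t := trunc_log p n.*2.
have p1 := prime_gt1 pp.
suff le_t : logn p 'C(n.*2, n) <= t.
  apply: leq_trans (trunc_logP p1 _); last by rewrite double_gt0.
  by rewrite leq_exp2l.
have len2 : n <= n.*2 by lia.
have := bin_fact len2; have -> : n.*2 - n = n by lia.
move/(congr1 (logn p)).
rewrite lognM ?muln_gt0 ?fact_gt0 ?bin_gt0 // lognM ?fact_gt0 //.
rewrite (logn_fact_wide pp len2) (logn_fact_wide pp (leqnn _)) => eqC.
rewrite -(leq_add2r (\sum_(1 <= k < n.*2.+1) (n %/ p ^ k + n %/ p ^ k))).
rewrite [X in _ + X <= _]big_split /= eqC.
apply: (@leq_trans (\sum_(1 <= k < n.*2.+1)
   ((k <= t : nat) + (n %/ p ^ k + n %/ p ^ k)))).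
  apply: leq_sum => k _; case: (leqP k t) => [_|ltk].
    have q0 : 0 < p ^ k by rewrite expn_gt0 prime_gt0.
    rewrite add1n -ltnS ltn_divLR //.
    have := divn_eq n (p ^ k); have := ltn_pmod n q0; nia.
  rewrite divn_small //; apply: leq_trans (trunc_log_ltn _ p1) _.
  by rewrite leq_exp2l.
rewrite big_split /= sum_leq_minn leq_add2r.
exact: geq_minr.
Qed.

Definition prime_pi m := count prime (iota 0 m.+1).

Lemma bin_double_lower n : 2 ^ n <= 'C(n.*2, n).
Proof.
elim: n => // n IHn; rewrite doubleS binS [X in X + _]binS expnS.
have : 'C(n.*2, n) <= 'C(n.*2.+1, n).
  by case: n {IHn} => // n; rewrite binS leq_addr.
by lia.
Qed.

(** The central binomial coefficient is at least [2 ^ n] and is a product of at most [prime_pi n.*2]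
    prime powers, each at most [2n]. *)
Lemma prime_pi_lower_even n : 0 < n -> 2 ^ n <= n.*2 ^ prime_pi n.*2.
Proof.
move=> n0; apply: leq_trans (bin_double_lower n) _.
have len2 : n <= n.*2 by lia.
have C0 : 0 < 'C(n.*2, n) by rewrite bin_gt0.
rewrite [X in X <= _](prod_prime_decomp C0) prime_decompE big_map /=.
apply: (@leq_trans (\prod_(p <- primes 'C(n.*2, n)) n.*2)).
  rewrite big_seq [X in _ <= X]big_seq; apply: leq_prod => p.
  by rewrite mem_primes => /and3P[pp _ _]; apply: expn_logn_bin.
rewrite big_const_seq count_predT iter_muln_1 leq_exp2l; last by lia.
rewrite /prime_pi -size_filter; apply: uniq_leq_size (primes_uniq _) _ => p.
rewrite mem_primes mem_filter mem_iota => /and3P[pp _ pC]; rewrite pp /=.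
rewrite add0n ltnS; have : p %| (n.*2)`!.
  by rewrite -(bin_fact len2) dvdn_mulr.
rewrite fact_prod big_nat_cond => /(big_ind (fun x => p %| x -> p <= n.*2)).
by apply=> [|x y IHx IHy|i /andP[/andP[i0 ilt] _] /dvdn_leq]; rewrite ?Euclid_dvdM //;
  [rewrite dvdn1 => /eqP p1; rewrite p1 in pp | case/orP | lia].
Qed.

(** The logarithm is that of [N], so that the factor stays the same when [m] runs over the quotients
    [N %/ r]. The 3 comes from [2n + 1 <= 3n]. *)
Lemma prime_pi_lower N m : 2 <= m <= N ->
  m <= 3 * ((trunc_log 2 N).+1 * prime_pi m).
Proof.
case/andP=> m2 mN; set L := (trunc_log 2 N).+1.
have [n mE] : exists n, (m = n.*2) \/ (m = n.*2.+1).
  exists m./2; have := odd_double_half m; case: (odd m); lia.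
have n0 : 0 < n by lia.
have piM : prime_pi n.*2 <= prime_pi m.
  case: mE => ->; rewrite // /prime_pi -[n.*2.+2]addn1 iotaD count_cat.
  exact: leq_addr.
have ltL : n.*2 <= 2 ^ L.
  apply: (@leq_trans N); first lia.
  by rewrite ltnW // trunc_log_ltn.
suff : n <= L * prime_pi n.*2 by nia.
have := prime_pi_lower_even n0 => H.
have : 2 ^ n <= 2 ^ (L * prime_pi n.*2).
  by apply: leq_trans H _; rewrite expnM; case: (prime_pi _) => // k; rewrite leq_exp2r.
by rewrite leq_exp2l.
Qed.

(** * Primes in a class modulo a power of 2 *)

Lemma logn2_fact n : logn 2 n`! <= n.
Proof.
rewrite logn_fact //.
(* The added term [n %/ 2 ^ m] makes the bound inductive: each halving splits it in two. *)
suff : forall m, \sum_(1 <= k < m.+1) n %/ 2 ^ k + n %/ 2 ^ m <= n.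
  by move/(_ n); apply: leq_trans; apply: leq_addr.
elim=> [|m IHm]; first by rewrite big_geq // divn1.
by rewrite big_nat_recr //= !expnSr !divnMA; move: IHm; set x := n %/ 2 ^ m; lia.
Qed.

Lemma prod_primes_dvd s m : uniq s -> all prime s ->
  {in s, forall p, p %| m} -> \prod_(p <- s) p %| m.
Proof.
elim: s => [|p s IHs] /=; first by rewrite big_nil dvd1n.
move=> /andP[ps us] /andP[pp prs] sm; rewrite big_cons Gauss_dvd.
  by rewrite sm ?mem_head //= IHs // => q qs; rewrite sm // inE qs orbT.
rewrite big_seq; elim/big_rec: _ => [|q x qs cx]; first exact: coprimen1.
rewrite coprimeMr cx andbT prime_coprime //.
rewrite dvdn_prime2 ?(allP prs q qs) //; by apply: contraNneq ps => ->.
Qed.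

Lemma fact_dvd_rising b n : n`! %| \prod_(j < n) (b + j).
Proof.
case: n => [|n]; first by rewrite big_ord0.
have -> : \prod_(j < n.+1) (b + j) = (b + n) ^_ n.+1.
  rewrite ffact_prod (reindex_inj rev_ord_inj) /=.
  by apply: eq_bigr => i _; have := ltn_ord i; lia.
by rewrite -bin_ffact dvdn_mull.
Qed.

(** Modulo [u], [a] is a multiple [M b], so the product becomes [M ^ n] times a product of [n]
    consecutive integers, which [n!] divides. *)
Lemma dvdn_prod_AP M a u n : 0 < M -> coprime M u -> u %| n`! ->
  u %| \prod_(j < n) (M * j + a).
Proof.
move=> M0 cMu un; pose b := chinese M u 0 a %/ M.
have bE : M * b = a %[mod u].
  rewrite mulnC divnK ?chinese_modr //.
  by rewrite /dvdn chinese_modl // mod0n.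
have -> : (u %| \prod_(j < n) (M * j + a)) = (u %| \prod_(j < n) (M * (b + j))).
  rewrite /dvdn; congr (_ == 0).
  apply: (big_ind2 (fun x y => x = y %[mod u])) => // [x1 x2 y1 y2 Hx Hy|j _].
    by rewrite -modnMm Hx Hy modnMm.
  by rewrite mulnDr addnC -modnDml -bE modnDml.
rewrite big_split /= dvdn_mull //.
exact: dvdn_trans un (fact_dvd_rising _ _).
Qed.

(* [n! / 2^v] divides the product of the first [n] terms of the progression and
   is coprime to the primes above [n]; comparing sizes bounds their product. *)
Lemma prod_primes_AP_le k a n : a < 2 ^ k -> odd a ->
  \prod_(p <- iota 0 (2 ^ k * n) | [&& prime p, n < p & p %% 2 ^ k == a]) p
    <= 2 ^ (k.+1 * n).
Proof.
move=> aM oa; set M := 2 ^ k; have M0 : 0 < M by rewrite expn_gt0.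
rewrite -big_filter; set s := seq.filter _ _.
pose u := n`!`_2^'; pose Pi := \prod_(j < n) (M * j + a).
have Pi0 : 0 < Pi by rewrite prodn_gt0 // => j; case: a oa {aM s Pi} => //; lia.
have u0 : 0 < u by exact: part_gt0.
have un : u %| n`! by exact: dvdn_part.
have cMu : coprime M u.
  rewrite coprime_pexpl ?prime_coprime //; last first.
    by case: k aM @M {M0 s Pi Pi0} => // ; case: a oa => // [[]].
  rewrite -p'natE //; exact: part_pnat.
have mem_s p : p \in s -> [/\ prime p, n < p, p %% M = a & p < M * n].
  by rewrite mem_filter mem_iota => /andP[/and3P[-> -> /eqP ->]].
have dPi : (\prod_(p <- s) p) * u %| Pi.
  have uPi : u %| Pi by exact: dvdn_prod_AP.
  rewrite Gauss_dvd ?uPi ?andbT.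
    apply: prod_primes_dvd; first by rewrite filter_uniq ?iota_uniq.
      by apply/allP => p /mem_s[].
    move=> p /mem_s[_ _ pa pn].
    have jn : p %/ M < n by rewrite ltn_divLR // mulnC.
    rewrite /Pi (bigD1 (Ordinal jn)) //=.
    have -> : M * (p %/ M) + a = p by rewrite -pa mulnC -divn_eq.
    exact: dvdn_mulr.
  rewrite big_seq; elim/big_rec: _ => [|p x /mem_s[pp np _ _] cx].
    exact: coprime1n.
  rewrite coprimeMl cx andbT; apply: coprime_dvdr un _.
  rewrite prime_coprime // fact_prod big_nat_cond.
  elim/big_rec: _ => [|i y /andP[/andP[i0 ilt] _] cy].
    by rewrite dvdn1; apply: contraL pp => /eqP ->.
  by rewrite Euclid_dvdM // negb_or cy andbT gtnNdvd //; lia.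
have lePi : Pi <= M ^ n * n`!.
  have -> : M ^ n * n`! = \prod_(j < n) (M * j.+1).
    by rewrite big_split /= prod_nat_const card_ord fact_prod big_add1 big_mkord.
  by apply: leq_prod => j _; rewrite mulnS addnC leq_add2r ltnW.
(* The part of [n!] at 2 is at most [2 ^ n]; this turns the exponent [k] into [k.+1]. *)
have nE : n`! <= 2 ^ n * u.
  rewrite -{1}(partnC 2 (fact_gt0 n)) leq_mul2r p_part leq_exp2l //.
  by rewrite logn2_fact orbT.
rewrite -(leq_pmul2r u0); apply: leq_trans (dvdn_leq Pi0 dPi) _.
apply: leq_trans lePi _.
have -> : 2 ^ (k.+1 * n) * u = M ^ n * (2 ^ n * u).
  by rewrite mulSn expnD expnM mulnA [2 ^ n * _]mulnC.
by rewrite leq_mul2l nE orbT.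
Qed.

Definition prime_AP k b lo m :=
  count (fun p => [&& prime p, lo < p & p %% 2 ^ k == b %% 2 ^ k]) (iota 0 m).

(** Every prime counted exceeds [2 ^ e], so it contributes at least [e] to the binary logarithm of
    the product just bounded. *)
Lemma prime_AP_le_step k b e n : odd b -> 0 < k ->
  e * prime_AP k b (maxn n (2 ^ e)) (2 ^ k * n) <= k.+1 * n.
Proof.
move=> ob k0; rewrite -(@leq_exp2l 2) //.
have M0 : 0 < 2 ^ k by rewrite expn_gt0.
have odd_r : odd (b %% 2 ^ k) by rewrite -(prednK k0) expnS odd_mod // mul2n odd_double.
apply: leq_trans (prod_primes_AP_le n (ltn_pmod b M0) odd_r).
rewrite /prime_AP expnM -iter_muln_1 -big_const_seq.
rewrite big_mkcond [X in _ <= X]big_mkcond.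
apply: leq_prod => p _; rewrite gtn_max.
case: (prime p) (@prime_gt0 p) => //= /(_ isT) p0.
by case: (ltnP n p) => //= _; case: (_ == _); rewrite ?andbF ?andbT //; case: ltnP => // /ltnW.
Qed.

Lemma prime_AP_even k b e m : ~~ odd b -> 0 < k -> 0 < e ->
  prime_AP k b (2 ^ e) m = 0.
Proof.
move=> eb k0 e0; apply/eqP; rewrite -leqn0 leqNgt -has_count.
apply/hasPn => p _; apply/negP => /and3P[pp lp /eqP pb].
have op : odd p = odd b.
  have E : odd (2 ^ k) = false by rewrite -(prednK k0) expnS mul2n odd_double.
  by rewrite -(odd_mod p E) pb odd_mod.
have := even_prime pp; rewrite op (negbTE eb) => -[] // p2; subst p.
by move: lp; rewrite -{2}[2]expn1 ltn_exp2l //; lia.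
Qed.

(** Strong induction on [m]: with [n] about [m / 2 ^ k], the primes above [n] are bounded by the
    previous product estimate, those up to [n] by induction. *)
Lemma prime_AP_upper k b e m : 0 < k <= e -> 1 < k ->
  2 ^ k * (e * prime_AP k b (2 ^ e) m.+1) <= 4 * (k.+1 * m).
Proof.
case/andP=> k0 ke k1; set M := 2 ^ k.
have e0 : 0 < e by apply: leq_trans ke.
have M4 : 4 <= M by rewrite -[4]/(2 ^ 2) leq_exp2l.
case ob : (odd b); last by rewrite prime_AP_even ?ob // !muln0.
elim/ltn_ind: m => m IHm.
have [le_me | lt_em] := leqP m (2 ^ e).
  rewrite [prime_AP _ _ _ _](_ : _ = 0) ?muln0 //.
  apply/eqP; rewrite -leqn0 leqNgt -has_count; apply/hasPn => p.
  rewrite mem_iota add0n ltnS => /= le_pm; apply/negP => /and3P[_ ltp _].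
  by have := leq_trans ltp (leq_trans le_pm le_me); rewrite ltnn.
have Mm : M < m by apply: leq_ltn_trans lt_em; rewrite leq_exp2l.
pose n := (m %/ M).+1.
have lt_mMn : m < M * n by rewrite mulnC ltn_ceil //; lia.
have le_Mn : M * n <= m + M by rewrite mulnS addnC leq_add2r mulnC leq_divM.
have lt_nm : n < m by nia.
have split_n : prime_AP k b (2 ^ e) m.+1 <=
    prime_AP k b (2 ^ e) n.+1 + prime_AP k b (maxn n (2 ^ e)) (M * n).
  rewrite /prime_AP -!size_filter -size_cat; apply: uniq_leq_size.
    by rewrite filter_uniq ?iota_uniq.
  move=> p; rewrite mem_cat !mem_filter !mem_iota !add0n gtn_max !ltnS.
  case/andP=> /and3P[-> -> ->] /= le_pm.
  by case: leqP => //= _; apply: leq_ltn_trans lt_mMn.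
have := IHm n lt_nm; have := prime_AP_le_step e n ob k0.
rewrite -/M; set X := prime_AP _ _ _ _ => HX; set Y := prime_AP _ _ _ _ => HY.
have : M * (e * prime_AP k b (2 ^ e) m.+1) <= M * (e * Y) + M * (e * X).
  by rewrite -!mulnDr !leq_mul2l split_n !orbT.
move/leq_trans; apply; apply: (leq_trans (leq_add HY (leq_mul (leqnn M) HX))).
(* From [4 <= M] and [M < m], the left side is at most [2 M n <= 2 (m + M) <= 4 m]. *)
have : (M + 4) * n <= 4 * m by nia.
by move=> H; nia.
Qed.

(** * Almost primes in a class modulo a power of 2 *)

Lemma almost_primeP l n :
  reflect (exists s, [/\ size s = l, all prime s & n = \prod_(p <- s) p])
          (almost_prime l n).
Proof. exact: asboolP. Qed.

Lemma almost_primeM l p r : prime p -> almost_prime l r ->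
  almost_prime l.+1 (r * p).
Proof.
move=> pp /almost_primeP[s [ss sp ->]]; apply/almost_primeP.
by exists (p :: s); rewrite /= ss pp sp big_cons mulnC.
Qed.

Lemma almost_prime_exp2 l : almost_prime l (2 ^ l).
Proof.
elim: l => [|l IHl]; last by rewrite expnSr almost_primeM.
by apply/almost_primeP; exists [::]; rewrite big_nil.
Qed.

Lemma almost_prime_gt0 l n : almost_prime l n -> 0 < n.
Proof.
move=> /almost_primeP[s [_ /allP sp ->]].
by rewrite big_seq prodn_cond_gt0 // => p /sp /prime_gt0.
Qed.

Lemma dvdn_prod_primes p s : prime p -> all prime s ->
  p %| \prod_(q <- s) q -> p \in s.
Proof.
move=> pp; elim: s => [|q s IHs] /=.
  by rewrite big_nil dvdn1 => _ /eqP p1; rewrite p1 in pp.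
case/andP=> pq sp; rewrite big_cons Euclid_dvdM // dvdn_prime2 // inE.
by case: eqP => //= _; apply: IHs.
Qed.

Lemma size_primes_almost_prime l n : almost_prime l n -> size (primes n) <= l.
Proof.
case/almost_primeP=> s [<- sp nE]; apply: uniq_leq_size (primes_uniq _) _ => p.
rewrite mem_primes => /and3P[pp _]; rewrite nE; exact: dvdn_prod_primes.
Qed.

Lemma almost_prime_dvd_leq k l d q : almost_prime k d -> almost_prime l q ->
  d %| q -> k <= l.
Proof.
case/almost_primeP=> s [<- sp ->] /almost_primeP[t [<- tp ->]].
elim: s t sp tp => [|p s IHs] t //= /andP[pp sp] tp.
rewrite big_cons => dv.
have pt : p \in t by apply: dvdn_prod_primes => //; apply: dvdn_trans dv; exact: dvdn_mulr.
move: dv; rewrite (perm_big _ (perm_to_rem pt)) big_cons /=.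
rewrite dvdn_pmul2l ?prime_gt0 // => /IHs -/(_ sp).
have -> : size t = (size (rem p t)).+1 by rewrite size_rem // prednK //; case: t pt {tp}.
by rewrite ltnS; apply; apply/allP => x /mem_rem; exact: (allP tp).
Qed.

(** An [l]-almost prime contains at most [l] factors 2, so cancelling it costs at most [2 ^ l] in
    the modulus. *)
Lemma almost_prime_coprime2_cancel l r k d : almost_prime l r ->
  2 ^ (k + l) %| r * d -> 2 ^ k %| d.
Proof.
case/almost_primeP=> s [<- sp ->] {l r}.
elim: s d sp => [|p s IHs] d /=; first by rewrite big_nil addn0 mul1n.
case/andP=> pp sp; rewrite big_cons addnS -mulnA => dv; apply: IHs => //.
have [p2|p2] := eqVneq p 2.
  by move: dv; rewrite p2 expnS dvdn_pmul2l.
move: dv; rewrite Gauss_dvdr; last first.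
  by rewrite coprime_pexpl // prime_coprime // dvdn_prime2 // eq_sym.
by apply: dvdn_trans; rewrite dvdn_exp2l.
Qed.

Lemma almost_prime_factor_gt l q B : almost_prime l.+1 q -> B ^ l.+1 < q ->
  exists p r, [/\ prime p, B < p, almost_prime l r & q = r * p].
Proof.
case/almost_primeP=> s [ss sp ->] ltB.
have /hasP[p ps ltp] : has (fun p => B < p) s.
  apply: contraLR ltB => /hasPn leB; rewrite -leqNgt -ss.
  rewrite -iter_muln_1 -count_predT -big_const_seq big_seq [X in _ <= X]big_seq.
  by apply: leq_prod => p /leB; rewrite -leqNgt.
exists p, (\prod_(q <- rem p s) q).
rewrite (allP sp) // (perm_big _ (perm_to_rem ps)) big_cons mulnC; split=> //.
apply/almost_primeP; exists (rem p s); rewrite size_rem // ss; split=> //.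
by apply/allP => x /mem_rem; exact: (allP sp).
Qed.

Lemma mem_almost_primes l N q :
  (q \in almost_primes l N) = almost_prime l q && (q <= N).
Proof. by rewrite mem_filter mem_iota. Qed.

Lemma uniq_almost_primes l N : uniq (almost_primes l N).
Proof. by rewrite filter_uniq ?iota_uniq. Qed.

(* Each [q = r p] arises at most [l + 1] times, once per prime divisor. *)
Lemma sum_prime_pi_le l N R :
  \sum_(r <- almost_primes l R) prime_pi (N %/ r) <=
  l.+1 * almost_prime_pi l.+1 N.
Proof.
pose prs r := [seq p <- iota 0 (N %/ r).+1 | prime p].
pose S := [seq (r * p, p) | r <- almost_primes l R, p <- prs r].
pose T := [seq (q, p) | q <- almost_primes l.+1 N, p <- primes q].
apply: (@leq_trans (size S)).
  rewrite size_allpairs_dep sumnE big_map; apply: leq_sum => r _.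
  by rewrite size_filter.
apply: (@leq_trans (size T)).
  apply: uniq_leq_size.
    apply: allpairs_uniq_dep; first exact: uniq_almost_primes.
      by move=> r _; rewrite filter_uniq ?iota_uniq.
    move=> _ _ /allpairsPdep[r1 [p1 [_ h1 ->]]] /allpairsPdep[r2 [p2 [_ _ ->]]] /=.
    move: h1; rewrite mem_filter => /andP[pp1 _] [E E2]; move: E; rewrite -E2.
    by move/eqP; rewrite eqn_pmul2r ?prime_gt0 // => /eqP ->.
  move=> _ /allpairsPdep[r [p [hr hp ->]]].
  move: hr hp; rewrite mem_almost_primes mem_filter mem_iota add0n ltnS.
  move=> /andP[lr _] /andP[pp lep]; have r0 := almost_prime_gt0 lr.
  apply/allpairsPdep; exists (r * p), p; split=> //.
    by rewrite mem_almost_primes almost_primeM // mulnC -leq_divRL.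
  by rewrite mem_primes pp muln_gt0 r0 prime_gt0 // dvdn_mull.
rewrite size_allpairs_dep sumnE big_map mulnC /almost_prime_pi.
rewrite -sum1_size big_distrl /= big_seq [X in _ <= X]big_seq.
apply: leq_sum => q; rewrite mem_almost_primes mul1n => /andP[/size_primes_almost_prime].
by [].
Qed.

(** Chebyshev's bound at each [N %/ r]; the cutoff [N %/ B] guarantees [2 <= N %/ r]. *)
Lemma almost_prime_pi_lower l N B : 1 < B ->
  \sum_(r <- almost_primes l (N %/ B)) N %/ r <=
  3 * ((trunc_log 2 N).+1 * (l.+1 * almost_prime_pi l.+1 N)).
Proof.
move=> B1; apply: (@leq_trans (3 * ((trunc_log 2 N).+1 *
    \sum_(r <- almost_primes l (N %/ B)) prime_pi (N %/ r)))); last first.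
  by rewrite !leq_mul2l sum_prime_pi_le !orbT.
rewrite !big_distrr /= big_seq [X in _ <= X]big_seq; apply: leq_sum => r.
rewrite mem_almost_primes => /andP[/almost_prime_gt0 r0 leB].
apply: prime_pi_lower; rewrite leq_div andbT leq_divRL //.
by move: leB; rewrite leq_divRL; nia.
Qed.

(** An almost prime above [2 ^ (e * l.+1)] is [r p] with [p] above [2 ^ e]. For fixed [r], the class
    of [r p] modulo [2 ^ (k + l)] determines that of [p] modulo [2 ^ k]. *)
Lemma almost_primes_AP_le l N k e a :
  exists b, size [seq q <- almost_primes l.+1 N | q == a %[mod 2 ^ (k + l)]] <=
   (2 ^ (e * l.+1)).+1 +
   \sum_(r <- almost_primes l (N %/ 2 ^ e)) prime_AP k (b r) (2 ^ e) (N %/ r).+1.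
Proof.
pose P r p := [&& prime p, 2 ^ e < p & r * p == a %[mod 2 ^ (k + l)]].
pose prs r := [seq p <- iota 0 (N %/ r).+1 | P r p].
(* The first admissible prime represents the class; the default 0 occurs only when there is nothing
   to count. *)
exists (fun r => head 0 (prs r)).
pose S := [seq r * p | r <- almost_primes l (N %/ 2 ^ e), p <- prs r].
apply: (@leq_trans (size (iota 0 (2 ^ (e * l.+1)).+1 ++ S))).
  apply: uniq_leq_size; first by rewrite filter_uniq ?uniq_almost_primes.
  move=> q; rewrite mem_filter mem_almost_primes mem_cat mem_iota add0n ltnS.
  case/andP=> qa /andP[lq leqN]; case: (leqP q (2 ^ (e * l.+1))) => //=; rewrite expnM => ltq.
  have [p [r [pp ltp lr qE]]] := almost_prime_factor_gt lq ltq.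
  have r0 := almost_prime_gt0 lr.
  apply/allpairsPdep; exists r, p; split=> //.
    rewrite mem_almost_primes lr leq_divRL ?expn_gt0 //.
    by apply: leq_trans leqN; rewrite qE leq_mul2l ltnW ?orbT.
  rewrite mem_filter /P pp ltp -qE qa mem_iota add0n ltnS leq_divRL //.
  by rewrite mulnC -qE.
rewrite size_cat size_iota leq_add2l size_allpairs_dep sumnE big_map.
rewrite big_seq [X in _ <= X]big_seq; apply: leq_sum => r.
rewrite mem_almost_primes => /andP[lr _].
rewrite /prime_AP -size_filter; apply: uniq_leq_size.
  by rewrite filter_uniq ?iota_uniq.
move=> p pr; have p0r : head 0 (prs r) \in prs r.
  by case: (prs r) pr => //= ? ? _; rewrite mem_head.
move: p0r pr; set p0 := head _ _; rewrite !mem_filter.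
case/andP=> /and3P[_ _ /eqP rp0] _ /andP[/and3P[-> -> /eqP rp] ->]; rewrite andbT /=.
move: rp; rewrite -rp0; wlog lep : p p0 {rp0} / p0 <= p.
  by move=> W; case/orP: (leq_total p0 p) => /W // H /esym /H; rewrite eq_sym.
move/eqP; rewrite !eqn_mod_dvd ?leq_mul2l ?lep ?orbT // -mulnBr.
exact: almost_prime_coprime2_cancel.
Qed.

Lemma exp2_dominates C : exists h0, forall h, h0 <= h -> C * h.+1 <= 2 ^ h.
Proof.
exists (3 * C) => h; elim: h => [|h IHh]; first by rewrite leqn0 muln_eq0 /= => /eqP ->.
rewrite leq_eqVlt => /orP[/eqP <-|]; last first.
  rewrite ltnS => /IHh H; rewrite expnS; nia.
(* Base case: [2 ^ (3 C)] is the cube of [2 ^ C], hence at least [(C + 1) ^ 3], which exceeds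
   [C (3 C + 1)]. *)
have := ltn_expl C (ltnSn 1); rewrite [3 * C]mulnC expnM; set x := 2 ^ C.
move=> lt; apply: (@leq_trans (C.+1 ^ 3)); last by rewrite leq_exp2r.
by rewrite !expnS expn0; nia.
Qed.

Lemma almost_primes_AP_small l K : exists k N0, forall N a, N0 <= N ->
  K * size [seq q <- almost_primes l.+1 N | q == a %[mod 2 ^ k]] <=
  almost_prime_pi l.+1 N.
Proof.
set l' := l.+1.
have [k0 hk0] := exp2_dominates (96 * (l' * l') * K).
pose k := maxn k0 2.
have hk : 96 * (l' * l') * K * k.+1 <= 2 ^ k by apply: hk0; exact: leq_maxl.
have k1 : 1 < k by exact: leq_maxr.
have [h0 hh0] := exp2_dominates (48 * K * l' * 2 ^ l).
pose L0 := 2 * l' * k + h0.*2 + l'.*2.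
exists (k + l), (2 ^ L0) => N a leN.
set L := trunc_log 2 N.
have N0 : 0 < N by apply: leq_trans leN; rewrite expn_gt0.
have L0L : L0 <= L by exact: trunc_log_max.
(* This keeps [2 ^ (e * l')] below the square root of [N], while [e] is still comparable to [log N],
   which cancels the logarithm in the lower bound. *)
pose e := L %/ (2 * l').
have ke : k <= e by rewrite leq_divRL //; nia.
have eL : L.+1 <= 4 * (l' * e).
  by have := ltn_ceil L (isT : 0 < 2 * l'); rewrite -/e; nia.
have le_e : e * l' * 2 <= L.
  by rewrite -mulnA [l' * 2]mulnC; exact: leq_divM.
have [b] := almost_primes_AP_le l N k e a; rewrite -/l'.
set A := size _; set Pi := almost_prime_pi _ _ => leA.
have B1 : 1 < 2 ^ e by rewrite -{1}(expn0 2) ltn_exp2l //; lia.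
have low := almost_prime_pi_lower l N B1; rewrite -/L -/l' -/Pi in low.
have hS : 2 ^ k * (e * \sum_(r <- almost_primes l (N %/ 2 ^ e))
    prime_AP k (b r) (2 ^ e) (N %/ r).+1) <=
    4 * (k.+1 * \sum_(r <- almost_primes l (N %/ 2 ^ e)) N %/ r).
  rewrite !big_distrr /=; apply: leq_sum => r _; apply: prime_AP_upper => //.
  by rewrite ke andbT ltnW.
(* The single term [r = 2 ^ l] of the lower bound already shows that [Pi] is of order at least
   [N / log N]. *)
have PiL : 2 ^ L <= 2 ^ l.+1 * (3 * (L.+1 * (l' * Pi))).
  have lL : l <= L - e by nia.
  have ND : 2 ^ (L - e) <= N %/ 2 ^ e.
    rewrite leq_divRL ?expn_gt0 // -expnD subnK; last by nia.
    exact: trunc_logP.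
  have mem_l : 2 ^ l \in almost_primes l (N %/ 2 ^ e).
    rewrite mem_almost_primes almost_prime_exp2 (leq_trans _ ND) //.
    by rewrite leq_exp2l.
  have : N %/ 2 ^ l <= 3 * (L.+1 * (l' * Pi)).
    apply: leq_trans low; rewrite (perm_big _ (perm_to_rem mem_l)) big_cons.
    exact: leq_addr.
  have : 2 ^ (L - l) <= N %/ 2 ^ l.
    rewrite leq_divRL ?expn_gt0 // -expnD subnK; last by nia.
    exact: trunc_logP.
  have -> : 2 ^ L = 2 ^ l * 2 ^ (L - l) by rewrite -expnD subnKC //; nia.
  move=> H1 H2; rewrite expnS -mulnA (leq_trans _ (leq_pmull _ _)) //.
  by rewrite leq_mul2l (leq_trans H1 H2) orbT.
have small : 2 * K * (2 ^ (e * l')).+1 <= Pi.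
  pose h := L./2.
  have hL : L = odd L + h.*2 by rewrite odd_double_half.
  have lh : e * l' <= h by rewrite /h; lia.
  have ub : (2 ^ (e * l')).+1 <= 2 * 2 ^ h.
    have : 2 ^ (e * l') <= 2 ^ h by rewrite leq_exp2l.
    have : 0 < 2 ^ h by rewrite expn_gt0.
    lia.
  have H : 48 * K * l' * 2 ^ l * h.+1 <= 2 ^ h by apply: hh0; rewrite /h; lia.
  have hh : 2 ^ h * 2 ^ h <= 2 ^ L by rewrite -expnD leq_exp2l //; lia.
  have c0 : 0 < 12 * (2 ^ l * (l' * h.+1)).
    by rewrite !muln_gt0 expn_gt0.
  apply: leq_trans (leq_mul (leqnn _) ub) _; rewrite -(leq_pmul2l c0).
  apply: (@leq_trans (2 ^ L)).
    apply: leq_trans hh; apply: leq_trans (leq_mul H (leqnn _)).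
    by rewrite leq_eqVlt; apply/orP; left; apply/eqP; ring.
  apply: leq_trans PiL _.
  have Lh : L.+1 <= 2 * h.+1 by lia.
  apply: (@leq_trans (2 ^ l.+1 * (3 * (2 * h.+1 * (l' * Pi))))).
    by rewrite !leq_mul2l leq_mul2r Lh !orbT.
  by rewrite expnS leq_eqVlt; apply/orP; left; apply/eqP; ring.
(* After clearing denominators, the initial segment and the sum over [r] each have to take at most
   half of [Pi]. *)
have c0 : 0 < 2 * (2 ^ k * e) by rewrite !muln_gt0 expn_gt0 /=; lia.
rewrite -(leq_pmul2l c0).
set S := \sum_(r <- _) prime_AP _ _ _ _ in leA hS.
have H1 : 2 * (2 ^ k * e) * (K * A) <=
    2 ^ k * e * (2 * K * (2 ^ (e * l')).+1) + 2 * K * (2 ^ k * (e * S)).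
  apply: (@leq_trans (2 * (2 ^ k * e) * (K * ((2 ^ (e * l')).+1 + S)))).
    by rewrite !leq_mul2l leA !orbT.
  by rewrite leq_eqVlt; apply/orP; left; apply/eqP; ring.
apply: leq_trans H1 _.
have -> : 2 * (2 ^ k * e) * Pi = 2 ^ k * e * Pi + 2 ^ k * (e * Pi) by ring.
apply: leq_add; first by rewrite leq_mul2l small orbT.
apply: (@leq_trans (96 * (l' * l') * K * k.+1 * (e * Pi))); last first.
  by rewrite leq_mul2r hk orbT.
apply: (@leq_trans (2 * K * (4 * (k.+1 * (3 * (4 * (l' * e) * (l' * Pi))))))).
  rewrite leq_mul2l; apply/orP; right; apply: leq_trans hS _.
  rewrite !leq_mul2l /=; apply: leq_trans low _.
  by rewrite leq_mul2l leq_mul2r eL orbT.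
by rewrite leq_eqVlt; apply/orP; left; apply/eqP; ring.
Qed.

(** * Integers with few prime factors in common with n *)

Lemma count_periodic (P : pred nat) h m : (forall a, P (a + h) = P a) ->
  count P (iota 0 (m * h)) = m * count P (iota 0 h).
Proof.
move=> Ph; elim: m => // m IHm.
rewrite mulSn addnC iotaD count_cat IHm add0n mulSn addnC; congr (_ + _).
rewrite -[X in iota X](addn0 (m * h)) iotaDl count_map; apply: eq_count => a /=.
by elim: (m) => [|j IHj]; rewrite ?add0n // mulSn -addnA addnC Ph.
Qed.

Lemma totient_count n : totient n = count (coprime n) (iota 0 n).
Proof.
rewrite totient_count_coprime -sumn_count sumnE big_map.
by rewrite /index_iota subn0.
Qed.

Lemma count_coprime_mul n m : count (coprime n) (iota 0 (m * n)) = m * totient n.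
Proof. by rewrite count_periodic ?totient_count // => a; rewrite /coprime gcdnDr. Qed.

Lemma totientM_le d e : totient (d * e) <= d * totient e.
Proof.
rewrite -count_coprime_mul totient_count; apply: sub_count => a.
by rewrite coprimeMl => /andP[].
Qed.

(** Dyadic blocks, as for the harmonic series: the [2 ^ J] terms after [2 ^ J] are each at least
    [t / 2 ^ J.+1], so they add [t / 2]. *)
Lemma harmonic_sum_lower (f : nat -> nat) t J :
  (forall d, 0 < d <= 2 ^ J -> t <= d * f d) ->
  J * t <= 2 * \sum_(1 <= d < (2 ^ J).+1) f d.
Proof.
elim: J => [|J IHJ] ht; first by rewrite mul0n.
have J2 : 2 ^ J.+1 = 2 ^ J + 2 ^ J by rewrite expnS mul2n addnn.
have J0 : 0 < 2 ^ J by rewrite expn_gt0.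
rewrite (@big_cat_nat _ _ _ (2 ^ J).+1) /=; [|lia..].
have := IHJ _; set S := \sum_(_ <= d < _) f d => H.
rewrite mulSn mulnDr addnC leq_add //; first by apply: H => d hd; apply: ht; lia.
rewrite -(leq_pmul2l J0) mulnA -[2 ^ J * 2]expnSr big_distrr /=.
apply: (@leq_trans (\sum_((2 ^ J).+1 <= d < (2 ^ J.+1).+1) t)).
  by rewrite sum_nat_const_nat subSS J2 addnK.
rewrite big_nat_cond [X in _ <= X]big_nat_cond; apply: leq_sum => d.
rewrite andbT => /andP[d1 d2]; apply: leq_trans (ht d _) _; first by lia.
by rewrite leq_mul2r; apply/orP; right.
Qed.

(** For [n = (2 ^ J)!], every [d <= 2 ^ J] divides [n] and [totient n <= d * totient (n %/ d)]. The
    harmonic bound then meets the identity that the totients of the divisors of [n] sum to [n]. *)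
Lemma totient_small K : exists2 n, 0 < n & K * totient n <= n.
Proof.
pose J := 2 * K.
have [n n0 dvn] : exists2 n, 0 < n & forall d, 0 < d <= 2 ^ J -> d %| n.
  by exists (2 ^ J)`!; [exact: fact_gt0 | move=> d; exact: dvdn_fact].
exists n => //.
have H : J * totient n <= 2 * \sum_(1 <= d < (2 ^ J).+1) totient (n %/ d).
  apply: harmonic_sum_lower => d hd.
  by rewrite -{1}(divnK (dvn d hd)) mulnC totientM_le.
suff le_n : \sum_(1 <= d < (2 ^ J).+1) totient (n %/ d) <= n.
  by rewrite /J in H le_n; lia.
pose r := [seq d <- iota 0 n.+1 | d %| n].
have tot : \sum_(d <- r) totient d = n.
  rewrite big_filter -[RHS]cyclic.sum_totient_dvd.
  by rewrite -(big_mkord (fun d => d %| n) totient) /index_iota subn0.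
pose s := [seq n %/ d | d <- index_iota 1 (2 ^ J).+1].
rewrite -(big_map (fun d => n %/ d) xpredT totient) -/s -[X in _ <= X]tot.
have us : uniq s.
  rewrite map_inj_in_uniq ?iota_uniq // => x y.
  rewrite !mem_index_iota !ltnS => /dvn xn /dvn yn E.
  have x0 : 0 < x by exact: dvdn_gt0 xn.
  have q0 : 0 < n %/ x by rewrite divn_gt0; [exact: dvdn_leq | exact: x0].
  have Exy : n %/ x * x = n %/ x * y by rewrite (divnK xn) E (divnK yn).
  by apply/eqP; rewrite -(eqn_pmul2l q0) Exy.
have sr : {subset s <= r}.
  move=> x /mapP[d]; rewrite mem_index_iota ltnS => hd ->.
  by rewrite mem_filter dvdn_div ?dvn // mem_iota add0n ltnS leq_div.
have pe : perm_eq r (s ++ [seq x <- r | x \notin s]).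
  apply: uniq_perm; first by rewrite filter_uniq ?iota_uniq.
    rewrite cat_uniq us !filter_uniq ?iota_uniq // andbT.
    by apply/hasPn => x; rewrite mem_filter => /andP[].
  move=> x; rewrite mem_cat mem_filter /=.
  by case xs: (x \in s) => //=; rewrite sr.
by rewrite (perm_big _ pe) big_cat leq_addr.
Qed.

(** For positive [n]: [gcd(a, n)] has fewer than [k] prime factors, counted with multiplicity. *)
Definition rough k n a := ~~ has (fun d => almost_prime k d && (d %| a)) (divisors n).

Lemma rough_mul k n m a : 0 < n -> 0 < m -> rough k (m * n) a -> rough k n a.
Proof.
move=> n0 m0; apply: contra => /hasP[d]; rewrite -dvdn_divisors // => dn Pd.
by apply/hasP; exists d => //; rewrite -dvdn_divisors ?muln_gt0 ?m0 // dvdn_mull.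
Qed.

Lemma rough_periodic k n a : 0 < n -> rough k n (a + n) = rough k n a.
Proof.
move=> n0; congr negb; apply: eq_in_has => d; rewrite -dvdn_divisors // => dn.
by rewrite dvdn_addl.
Qed.

Lemma count_rough_mul k n m : 0 < n -> 0 < m ->
  count (rough k (m * n)) (iota 0 (m * n)) <= m * count (rough k n) (iota 0 n).
Proof.
move=> n0 m0; rewrite -count_periodic; last by move=> a; apply: rough_periodic.
by apply: sub_count => a; apply: rough_mul.
Qed.

Lemma count_has_le (T D : Type) (P : D -> pred T) (s : seq D) (r : seq T) :
  count (fun a => has (P^~ a) s) r <= \sum_(d <- s) count (P d) r.
Proof.
elim: s => [|d s IHs] /=; first by rewrite big_nil count_pred0.
by rewrite big_cons (leq_trans _ (leq_add (leqnn _) IHs)) // -count_predUI leq_addr.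
Qed.

(** Induction on [k]: if a [k]-almost prime [d] divides [n1] and [a], and [a / d] shares a prime
    with [n2], then [d] times this prime divides [n2 * n1] and [a]. What escapes is rough at level
    [k], or has [a / d] coprime to [n2], which is rare. *)
Lemma rough_small k K : exists2 n, 0 < n & K * count (rough k n) (iota 0 n) <= n.
Proof.
elim: k K => [|k IHk] K.
  exists 1 => //=; rewrite /rough /= (_ : almost_prime 0 1) ?muln0 //.
  exact: almost_prime_exp2.
have [n1 n10 h1] := IHk (2 * K).
(* The factor [n1] pays for the sum over the divisors of [n1], at most [n1] in number; the 2
   reserves half of the bound for each of the two cases. *)
have [n2 n20 h2] := totient_small (2 * K * n1).
exists (n2 * n1); first by rewrite muln_gt0 n20.
pose Q d a := (d %| a) && coprime n2 (a %/ d).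
have sub a : rough k.+1 (n2 * n1) a -> rough k n1 a || has (Q^~ a) (divisors n1).
  move=> ra; rewrite -implyNb; apply/implyP; rewrite negbK => /hasP[d dn /andP[kd da]].
  apply/hasP; exists d => //; rewrite /Q da /=; apply: contraT => nc.
  have g1 : 1 < gcdn n2 (a %/ d) by rewrite ltn_neqAle eq_sym nc gcdn_gt0 n20.
  have pp := pdiv_prime g1; have := pdiv_dvd (gcdn n2 (a %/ d)).
  rewrite dvdn_gcd => /andP[p2 pa]; case/negP: ra; apply/hasP.
  exists (d * pdiv (gcdn n2 (a %/ d))).
    rewrite -dvdn_divisors ?muln_gt0 ?n20 // mulnC dvdn_mul //.
    by rewrite dvdn_divisors.
  by rewrite almost_primeM //= mulnC -dvdn_divRL.
have le1 : count (rough k.+1 (n2 * n1)) (iota 0 (n2 * n1)) <=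
    n2 * count (rough k n1) (iota 0 n1) + n1 * (n1 * totient n2).
  rewrite -count_periodic; last by move=> a; apply: rough_periodic.
  apply: leq_trans (sub_count sub _) _.
  apply: (@leq_trans (count (rough k n1) (iota 0 (n2 * n1)) +
     count (fun a => has (Q^~ a) (divisors n1)) (iota 0 (n2 * n1)))).
    by rewrite -count_predUI leq_addr.
  rewrite leq_add2l; apply: leq_trans (count_has_le _ _ _) _.
  apply: (@leq_trans (\sum_(d <- divisors n1) n1 * totient n2)).
    rewrite big_seq [X in _ <= X]big_seq; apply: leq_sum => d.
    rewrite -dvdn_divisors // => dn1; have d0 := dvdn_gt0 n10 dn1.
    apply: (@leq_trans ((n1 %/ d) * totient n2)); last by rewrite leq_mul2r leq_div orbT.
    rewrite -count_coprime_mul -!size_filter -[X in _ <= X](size_map (muln d)).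
    apply: uniq_leq_size; first by rewrite filter_uniq ?iota_uniq.
    move=> a; rewrite mem_filter mem_iota add0n => /andP[/andP[da ca] lta].
    apply/mapP; exists (a %/ d); last by rewrite mulnC divnK.
    rewrite mem_filter ca mem_iota add0n /= ltn_divLR //.
    by rewrite mulnAC divnK // mulnC.
  rewrite big_const_seq count_predT iter_addn_0 mulnC leq_mul2r.
  apply/orP; right; rewrite -[X in _ <= X](size_iota 1 n1).
  apply: uniq_leq_size (divisors_uniq _) _ => d; rewrite -dvdn_divisors // => dn1.
  by rewrite mem_iota add1n ltnS (dvdn_gt0 n10 dn1) dvdn_leq.
have : K * count (rough k.+1 (n2 * n1)) (iota 0 (n2 * n1)) <=
   K * (n2 * count (rough k n1) (iota 0 n1) + n1 * (n1 * totient n2)).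
  by rewrite leq_mul2l le1 orbT.
have := leq_mul (leqnn n2) h1; have := leq_mul (leqnn n1) h2.
set c := count _ _; set t := totient _; set c' := count _ _.
nia.
Qed.

(** * The Toeplitz sequence *)

(** The bound [2 ^ l <= n] makes [almost_prime_pi l n] positive and the count of rough residues
    gives regularity. In the last clause [m.*2.+1] is the number of window classes, which together
    carry at most [2 ^ - (t + 3)] of the almost primes. *)
Definition sparse_step (l t m n : nat) : Prop :=
  [/\ m < n, m %| n, 2 ^ l <= n,
      t.+1 * count (rough l.+1 n) (iota 0 n) <= n &
      forall N a, n <= N ->
        2 ^ t.+3 * ((m.*2.+1) * size [seq q <- almost_primes l N | q == a %[mod n]])
          <= almost_prime_pi l N].

Lemma sparse_step_exists l t m : 0 < l -> 0 < m -> exists n, sparse_step l t m n.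
Proof.
case: l => // l _ m0.
have [h h0 hh] := rough_small l.+2 t.+1.
have [k [N0 hk]] := almost_primes_AP_small l (2 ^ t.+3 * m.*2.+1).
(* The new period is a multiple of [2 ^ k], [m] and [h], since the estimates pass to multiples;
   [B.+1] makes it large enough. *)
pose B := N0 + m + 2 ^ l.+1; pose c := 2 ^ k * m * B.+1.
have c0 : 0 < c by rewrite !muln_gt0 expn_gt0 m0.
have le_n x : x <= B -> x < c * h.
  move=> lex; rewrite -ltnS in lex; apply: leq_trans lex _.
  by rewrite /c -mulnA [_ * h]mulnC mulnA leq_pmull // !muln_gt0 expn_gt0 m0 h0.
exists (c * h); split.
- by apply: le_n; rewrite /B; set x := 2 ^ _; lia.
- by rewrite /c -!mulnA dvdn_mull // dvdn_mulr.
- by apply/ltnW/le_n; exact: leq_addl.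
- apply: leq_trans (leq_mul (leqnn t.+1) (count_rough_mul _ h0 c0)) _.
  by rewrite mulnCA leq_mul2l hh orbT.
move=> N a leN; rewrite mulnA; apply: leq_trans (hk N a _); last first.
  apply: leq_trans leN; apply/ltnW/le_n.
  by rewrite /B; set x := 2 ^ _; lia.
rewrite leq_mul2l; apply/orP; right.
rewrite !size_filter; apply: sub_count => q /eqP E; apply/eqP.
have kn : 2 ^ k %| c * h by rewrite /c -!mulnA dvdn_mulr.
by rewrite -(modn_dvdm q kn) E modn_dvdm.
Qed.

Definition sparse_sequence l (n : nat -> nat) :=
  (0 < n 0) /\ forall t, sparse_step l t (n t) (n t.+1).

Lemma sparse_sequence_exists l : 0 < l ->
  exists n, sparse_sequence l n.
Proof.
move=> l0.
have [g hg] : {g : nat -> nat -> nat | forall t m, 0 < m -> sparse_step l t m (g t m)}.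
  have step t m : {n | 0 < m -> sparse_step l t m n}.
    apply: cid; have [m0|m0] := posnP m; first by exists 0; rewrite m0.
    by have [n hn] := sparse_step_exists t l0 m0; exists n.
  by exists (fun t m => sval (step t m)) => t m; exact: (svalP (step t m)).
pose n := fix n t := if t is s.+1 then g s (n s) else 1.
exists n; split=> // t; apply: (hg).
by elim: t => //= t /(hg t) [lt _ _ _ _]; apply: leq_ltn_trans lt.
Qed.

(** * Classes prescribed at each stage *)

Local Open Scope classical_set_scope.
Local Open Scope ring_scope.

(** The classes modulo [n] of the integers of [[-w, w]]; the second disjunct is the negative half,
    read on nonnegative residues. *)
Definition window (w n : nat) (a : int) : bool :=
  let r := `|(a %% n%:Z)%Z|%N in (r <= w)%N || (n <= r + w)%N.

Lemma window_small w n a : (w < n)%N -> (`|a| <= w)%N -> window w n a.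
Proof.
move=> wn aw; rewrite /window.
have [a0|a0] := leP 0 a; first by rewrite modz_small ?aw //; lia.
rewrite -modzDr modz_small; last lia.
by apply/orP; right; lia.
Qed.

Lemma window_periodic w n a k : window w n (a + k * n%:Z) = window w n a.
Proof. by rewrite /window addrC modzMDl. Qed.

Lemma count_window_le l N w n K C : (w < n)%N ->
  (forall a, (K * (w.*2.+1 *
     size [seq q <- almost_primes l N | q == a %[mod n]]) <= C)%N) ->
  (K * count (fun q : nat => window w n q%:Z) (almost_primes l N) <= C)%N.
Proof.
move=> wn hC; pose W := iota 0 w.+1 ++ iota (n - w) w.
have sW : size W = w.*2.+1 by rewrite size_cat !size_iota -addnn addSn.
pose P r q := (q == r %[mod n])%N.
have le1 : (count (fun q : nat => window w n q%:Z) (almost_primes l N) <=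
            count (fun q => has (P^~ q) W) (almost_primes l N))%N.
  apply: sub_count => q; rewrite /window modz_nat absz_nat => Wq.
  apply/hasP; exists (q %% n)%N; last by rewrite /P modn_mod.
  rewrite mem_cat !mem_iota; have := ltn_pmod q (leq_ltn_trans (leq0n w) wn).
  by lia.
apply: leq_trans (leq_mul (leqnn K) le1) _.
apply: leq_trans (leq_mul (leqnn K) (count_has_le _ _ _)) _.
rewrite -(leq_pmul2l (ltn0Sn w.*2)) !big_distrr /=.
apply: (@leq_trans (\sum_(r <- W) C)); last first.
  by rewrite big_const_seq count_predT iter_addn_0 sW mulnC.
by apply: leq_sum => r _; rewrite mulnCA -size_filter; exact: hC.
Qed.

(* The classes prescribed at stage [t]. The first disjunct has density close to
   1, which gives regularity, and contains no [l]-almost prime. *)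
Definition filled (l : nat) (n : nat -> nat) (t : nat) (a : int) : bool :=
  ~~ rough l.+1 (n t.+1) `|a| || window (n t) (n t.+1) a.

Section SparseSequence.
Context (l : nat) (n : nat -> nat) (hn : sparse_sequence l n).

Lemma sparse_gt t : (t < n t)%N.
Proof.
elim: t => [|t IHt]; first by case: hn.
by case: (hn.2 t) => lt _ _ _ _; apply: leq_ltn_trans lt.
Qed.

Lemma sparse_dvd s t : (s <= t)%N -> (n s %| n t)%N.
Proof.
move/subnK <-; elim: (t - s)%N => // j IHj; rewrite addSn.
by case: (hn.2 (j + s)%N) => _ dv _ _ _; exact: dvdn_trans dv.
Qed.

Lemma sparse_leq s t : (s <= t)%N -> (n s <= n t)%N.
Proof. by move/sparse_dvd/dvdn_leq; apply; exact: leq_ltn_trans (sparse_gt t). Qed.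

Lemma filled_periodic s t a k : (s <= t)%N ->
  filled l n s (a + k * (n t.+1)%:Z) = filled l n s a.
Proof.
move=> st; have /dvdnP[c cE] := sparse_dvd (st : (s.+1 <= t.+1)%N).
rewrite cE PoszM mulrA /filled window_periodic; congr (~~ _ || _).
have n0 : (0 < n s.+1)%N by exact: leq_ltn_trans (sparse_gt _).
congr negb; apply: eq_in_has => d; rewrite -dvdn_divisors // => dn.
congr (_ && _); rewrite -[(d %| _)%N]/(d%:Z %| _)%Z -[RHS]/(d%:Z %| _)%Z.
by rewrite rpredDr // dvdz_mull.
Qed.

Lemma filled_small t a : (`|a| <= n t)%N -> filled l n t a.
Proof.
move=> leat; apply/orP; right; apply: window_small => //.
by case: (hn.2 t).
Qed.

(** No [l]-almost prime has a divisor with [l.+1] prime factors, so only the window classes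
    count. *)
Lemma count_filled_le s N : (n s.+1 <= N)%N ->
  (2 ^ s.+3 * count (fun q : nat => filled l n s q%:Z) (almost_primes l N)
     <= almost_prime_pi l N)%N.
Proof.
move=> leN; have [lt _ _ _ hC] := hn.2 s.
rewrite (@eq_in_count _ _ (fun q : nat => window (n s) (n s.+1) q%:Z)).
  by apply: count_window_le => // a; exact: hC.
move=> q; rewrite mem_almost_primes => /andP[lq _].
rewrite /filled negbK orb_idl // => /hasP[d _ /andP[kd dq]].
by have := almost_prime_dvd_leq kd lq dq; rewrite ltnn.
Qed.

Lemma count_filled_before_le t :
  (4 * count (fun q : nat => has (filled l n ^~ q%:Z) (iota 0 t))
     (almost_primes l (n t)) <= almost_prime_pi l (n t))%N.
Proof.
set Pi := almost_prime_pi _ _.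
pose c s := count (fun q : nat => filled l n s q%:Z) (almost_primes l (n t)).
(* Integer form of the geometric sum: the first [j] stages take at most [(1 - 2 ^ - j) / 4] of
   [Pi]. *)
suff H j : (j <= t)%N -> (2 ^ j.+2 * \sum_(s <- iota 0 j) c s + Pi <= 2 ^ j * Pi)%N.
  have := H t (leqnn t).
  have := @count_has_le _ _ (fun s q : nat => filled l n s q%:Z) (iota 0 t)
    (almost_primes l (n t)).
  rewrite -/(c _); set S := (\sum_(_ <- _) _)%N; set B := count _ _ => BS.
  have -> : (2 ^ t.+2 = 4 * 2 ^ t)%N by rewrite !expnS mulnA.
  have : (0 < 2 ^ t)%N by rewrite expn_gt0.
  set x := (2 ^ t)%N => x0 Hx.
  rewrite -(leq_pmul2l x0); nia.
elim: j => [_|j IHj jt]; first by rewrite big_nil muln0 mul1n.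
have := count_filled_le (sparse_leq jt); rewrite -/(c j) -/Pi.
have := IHj (ltnW jt); rewrite -[j.+1]addn1 iotaD big_cat big_cons big_nil /= add0n addn0.
set S := (\sum_(_ <- _) _)%N; rewrite addn1 !expnS; set x := (2 ^ j)%N.
by nia.
Qed.

Lemma filled_exists a : exists t, filled l n t a.
Proof. by exists `|a|%N; apply: filled_small; exact/ltnW/sparse_gt. Qed.

Definition stage_parity : full_shift := fun a => odd (ex_minn (filled_exists a)).

Lemma stage_parityE t a : filled l n t a -> ~~ has (filled l n ^~ a) (iota 0 t) ->
  stage_parity a = odd t.
Proof.
move=> ft /hasPn lts; rewrite /stage_parity; case: ex_minnP => m fm mmin.
congr odd; apply/eqP; rewrite eqn_leq mmin //= leqNgt; apply/negP => mt.
by have := lts m; rewrite mem_iota fm => /(_ mt).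
Qed.

(** The stages up to [t] are all [n t.+1]-periodic, so [a] and its translates are first prescribed
    at the same stage. *)
Lemma filled_Per t a : filled l n t a -> Per (n t.+1) stage_parity a.
Proof.
move=> ft k; rewrite /stage_parity; case: ex_minnP => i fi imin.
case: ex_minnP => j fj jmin; congr odd.
have it := imin t ft; have jt : (j <= t)%N by apply: jmin; rewrite filled_periodic.
apply/eqP; rewrite eqn_leq imin /= ?jmin ?filled_periodic //.
by move: fj; rewrite filled_periodic.
Qed.

Lemma periodic_structure_stage_parity : periodic_structure stage_parity n.
Proof.
split=> [t|t|]; first exact: leq_ltn_trans (sparse_gt t).
  exact: sparse_dvd.
apply/seteqP; split=> // a _; have [t ft] := filled_exists a.
by exists t.+1 => //; exact: filled_Per.
Qed.

Lemma toeplitz_stage_parity : toeplitz stage_parity.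
Proof.
move=> a; have [t ft] := filled_exists a.
by exists (n t.+1); [exact: leq_ltn_trans (sparse_gt _) | exact: filled_Per].
Qed.

End SparseSequence.

(** * Densities and averages *)

Definition period_count (n : nat) (A : set int) : nat :=
  count (fun i : nat => i%:Z \in A) (iota 0 n).

(** Moving a window of length [n] by one step replaces one end by an integer congruent to it. *)
Lemma count_window_shift (A : set int) n N : (forall a, A (a + n%:Z) = A a) ->
  count (fun i : nat => i%:Z - N%:Z \in A) (iota 0 n) = period_count n A.
Proof.
move=> An; elim: N => [|N IHN]; first by apply: eq_count => i; rewrite subr0.
rewrite -IHN; case: n An {IHN} => // n An.
have -> : iota 0 n.+1 = rcons (iota 0 n) n by rewrite -cats1 -addn1 iotaD.
rewrite -[in RHS]cats1 count_cat /= addn0 addnC.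
have -> : rcons (iota 0 n) n = 0%N :: map S (iota 0 n).
  by rewrite -cats1 -(iotaDl 1) -(iotaD 0 n 1) addn1.
rewrite /= count_map; congr (nat_of_bool _ + _)%N.
  by apply: asbool_equiv_eq; rewrite -An (_ : _ + _ = n%:Z - N%:Z) //; lia.
by apply: eq_count => i /=; congr (_ \in A); lia.
Qed.

Lemma cvg_natural_density (R : realType) (A : set int) n : (0 < n)%N ->
  (forall a, A (a + n%:Z) = A a) ->
  (fun N : nat => (\sum_(i < N.*2.+1) \1_A (i%:Z - N%:Z)) / (N.*2.+1)%:R : R)
    @ \oo --> ((period_count n A)%:R / n%:R : R).
Proof.
move=> n0 An; set c := period_count n A.
have cn : (c <= n)%N by rewrite /c /period_count (leq_trans (count_size _ _)) ?size_iota.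
pose S N := count (fun i : nat => i%:Z - N%:Z \in A) (iota 0 N.*2.+1).
have SE N : \sum_(i < N.*2.+1) \1_A (i%:Z - N%:Z) = (S N)%:R :> R.
  rewrite /S -sumn_count sumnE big_map natr_sum -(big_mkord xpredT (fun i : nat => \1_A (i%:Z - N%:Z))).
  by rewrite /index_iota subn0; apply: eq_bigr => i _; rewrite indicE.
(* Whole periods plus fewer than [n] further terms: the count is within [n] of its expected
   value. *)
have Sb N : (S N * n <= N.*2.+1 * c + n * n /\ N.*2.+1 * c <= S N * n + n * n)%N.
  have E := divn_eq N.*2.+1 n; set q := (N.*2.+1 %/ n)%N in E; set r := (_ %% n)%N in E.
  have rn : (r < n)%N by exact: ltn_pmod.
  pose P (i : nat) := i%:Z - N%:Z \in A.
  have -> : S N = (q * c + count P (iota (q * n) r))%N.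
    rewrite /S E iotaD count_cat count_periodic ?count_window_shift //.
    by move=> a; rewrite PoszD addrAC; apply: asbool_equiv_eq; rewrite An.
  have := count_size P (iota (q * n) r).
  rewrite size_iota E; set x := count _ _ => xr.
  nia.
move: S SE Sb => S SE Sb; apply/cvgrPdist_le => e e0; near=> N.
rewrite SE.
have n0R : 0 < n%:R :> R by rewrite ltr0n.
have N0R : 0 < N.*2.+1%:R :> R by rewrite ltr0n.
have big : n%:R / e <= N.*2.+1%:R.
  apply: (@le_trans _ _ N%:R); last by rewrite ler_nat; lia.
  by near: N; exact: nbhs_infty_ger.
have [H1 H2] := Sb N.
move: H1 H2; rewrite -!(ler_nat R) !natrD !natrM => H1 H2.
have -> : c%:R / n%:R - (S N)%:R / N.*2.+1%:R =
   (N.*2.+1%:R * c%:R - (S N)%:R * n%:R) / (n%:R * N.*2.+1%:R) :> R.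
  by field; rewrite !gt_eqF.
rewrite normrM normfV [`|n%:R * _|]gtr0_norm ?mulr_gt0 // ler_pdivrMr ?mulr_gt0 //.
apply: (@le_trans _ _ (n%:R * n%:R)); first by rewrite ler_norml; apply/andP; split; lra.
by rewrite mulrCA ler_pM2l // mulrC -ler_pdivrMr.
Unshelve. all: by end_near.
Qed.

Lemma natural_density_periodic (R : realType) (A : set int) n : (0 < n)%N ->
  (forall a, A (a + n%:Z) = A a) ->
  natural_density R A = (period_count n A)%:R / n%:R.
Proof. by move=> n0 An; apply: cvg_lim => //; exact: cvg_natural_density. Qed.

Lemma Per_periodic n x a : Per n x (a + n%:Z) = Per n x a.
Proof.
apply/propext; split=> H k.
  have E : x a = x (a + n%:Z) by rewrite (H (-1)); congr x; lia.
  rewrite E (H (k - 1)); congr x; lia.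
have <- : x a = x (a + n%:Z) by rewrite (H 1); congr x; lia.
rewrite (H (k + 1)); congr x; lia.
Qed.

(** Integers that are not rough are filled, so the density at index [t.+1] is at least
    [1 - 1 / (t + 1)]. *)
Lemma regular_stage_parity (R : realType) l n (hn : sparse_sequence l n) :
  regular_toeplitz R (stage_parity hn).
Proof.
exists n; first exact: periodic_structure_stage_parity.
rewrite -(cvg_shiftS (fun t => natural_density R (Per (n t) (stage_parity hn)))).
have n0 t : (0 < n t)%N by exact: leq_ltn_trans (sparse_gt hn t).
apply: (@squeeze_cvgr _ _ _ _ (fun t => 1 - harmonic t) (cst 1)); last 2 first.
- by rewrite -[X in _ --> X]subr0; apply: cvgB; [exact: cvg_cst | exact: cvg_harmonic].
- exact: cvg_cst.
apply: nearW => t /=.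
rewrite (natural_density_periodic R (n0 t.+1)); last by move=> a; exact: Per_periodic.
set c := period_count _ _.
have cn : (c <= n t.+1)%N by rewrite (leq_trans (count_size _ _)) ?size_iota.
have [_ _ _ hr _] := hn.2 t.
have cr : (n t.+1 <= c + count (rough l.+1 (n t.+1)) (iota 0 (n t.+1)))%N.
  rewrite -[X in (X <= _)%N](size_iota 0) -(count_predC (rough l.+1 (n t.+1))) addnC.
  rewrite leq_add2r; apply: sub_count => i ri; rewrite inE.
  by apply: filled_Per; rewrite /filled absz_nat; apply/orP; left.
set r := count _ _ in hr cr.
have N0R : 0 < (n t.+1)%:R :> R by rewrite ltr0n.
apply/andP; split; last by rewrite ler_pdivrMr // mul1r ler_nat.
rewrite ler_pdivlMr // mulrBl mul1r.
have t0 : 0 < t.+1%:R :> R by rewrite ltr0n.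
have : r%:R <= t.+1%:R^-1 * (n t.+1)%:R :> R.
  by rewrite ler_pdivlMl // -natrM ler_nat.
have : (n t.+1)%:R <= c%:R + r%:R :> R by rewrite -natrD ler_nat.
rewrite -lerBlDr => h1 h2; apply: le_trans h1.
by rewrite lerD2l lerN2.
Qed.

(** * Averages over almost primes and their oscillation *)

Lemma almost_prime_avg_close (R : realType) l N (u : nat -> R) (c : R) (bad : pred nat) :
  (0 < almost_prime_pi l N)%N ->
  (forall q, `|u q - c| <= 2) ->
  (forall q, almost_prime l q -> (q <= N)%N -> ~~ bad q -> u q = c) ->
  (4 * count bad (almost_primes l N) <= almost_prime_pi l N)%N ->
  `|almost_prime_avg l N u - c| <= 1 / 2.
Proof.
move=> pi0 u2 uc hbad; have pi0R : 0 < (almost_prime_pi l N)%:R :> R by rewrite ltr0n.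
have -> : almost_prime_avg l N u - c =
    (almost_prime_pi l N)%:R^-1 * \sum_(q <- almost_primes l N) (u q - c).
  rewrite /almost_prime_avg sumrB mulrBr; congr (_ - _).
  rewrite big_const_seq count_predT iter_addr_0 -[c *+ _]mulr_natl mulrA mulVf ?mul1r //.
  by rewrite gt_eqF.
rewrite normrM normfV (gtr0_norm pi0R) ler_pdivrMl //.
(* Only bad terms contribute, each at most 2, and they form at most a quarter. *)
apply: (@le_trans _ _ (2 * (count bad (almost_primes l N))%:R)).
  apply: le_trans (ler_norm_sum _ _ _) _.
  rewrite -sumn_count sumnE big_map natr_sum mulr_sumr.
  rewrite big_seq [leRHS]big_seq; apply: ler_sum => q.
  rewrite mem_almost_primes => /andP[lq qN].
  have [bq|bq] := boolP (bad q); first by rewrite mulr1.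
  by rewrite uc // subrr normr0 mulr0.
have : (4 * count bad (almost_primes l N))%:R <= (almost_prime_pi l N)%:R :> R.
  by rewrite ler_nat.
rewrite natrM; lra.
Qed.

(** Consecutive terms differ by at least 1, whereas two terms within [1 / 4] of a limit would differ
    by less than [1 / 2]. *)
Lemma not_cvgn_alternating (R : realType) (v : nat -> R) :
  (forall t, (0 < t)%N -> `|v t - (-1) ^+ t| <= 1 / 2) -> ~ cvgn v.
Proof.
move=> hv /cvg_ex[L /cvgrPdist_lt vL].
have e0 : 0 < 1 / 4 :> R by lra.
have [N _ hN] := vL _ e0.
have h1 := hN N.+1 (leqnSn N); have h2 := hN N.+2 (leqW (leqnSn N)).
have h3 := hv N.+1 isT; have h4 := hv N.+2 isT; rewrite exprS in h4.
move: h1 h2 h3 h4; rewrite /= !ler_norml !ltr_norml.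
have [->|->] : (-1) ^+ N.+1 = 1 :> R \/ (-1) ^+ N.+1 = -1 :> R.
- by rewrite -signr_odd; case: odd; [right|left].
- by move=> /andP[? ?] /andP[? ?] /andP[? ?] /andP[? ?]; lra.
- by move=> /andP[? ?] /andP[? ?] /andP[? ?] /andP[? ?]; lra.
Qed.

Lemma signF_iter_shift (R : realType) (x : full_shift) q :
  signF R (iter q left_shift x) = (-1) ^+ (x q%:Z).
Proof.
rewrite /signF; congr (_ ^+ nat_of_bool _).
suff -> : iter q left_shift x = shiftz q%:Z x by rewrite /shiftz add0r.
elim: q => [|q IHq]; first by apply/funext => a; rewrite /shiftz addr0.
by rewrite iterS IHq; apply/funext => a; rewrite /left_shift /shiftz; congr x; lia.
Qed.

Lemma continuous_signF (R : realType) : continuous (signF R).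
Proof.
move=> y; apply: (@continuous_comp full_shift bool R (fun z => z 0)
  (fun b : bool => (-1) ^+ b)).
  exact: (@proj_continuous _ (fun _ : int => bool) 0).
move=> A /nbhs_singleton hA.
by have h := @discrete_set1 bool (y 0); apply: (filterS _ h) => b ->.
Qed.

Lemma not_cvgn_stage_parity (R : realType) l n (hn : sparse_sequence l n) :
  ~ cvgn (fun t => almost_prime_avg l (n t)
                     (fun q => signF R (iter q left_shift (stage_parity hn)))).
Proof.
apply: not_cvgn_alternating => t t0.
apply: (almost_prime_avg_close (bad := fun q => has (filled l n ^~ q%:Z) (iota 0 t))).
(* [2 ^ l] is an [l]-almost prime up to [n t.+1], so the average is over a nonempty set. *)
- case: t t0 => // t _; have [_ _ le2 _ _] := hn.2 t.
  rewrite /almost_prime_pi lt0n size_eq0; apply/eqP => E.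
  by have := mem_almost_primes l (n t.+1) (2 ^ l)%N; rewrite E almost_prime_exp2 le2.
- move=> q; rewrite signF_iter_shift -[_ ^+ t]signr_odd.
  by case: (stage_parity hn q); case: odd; rewrite ?expr0 ?expr1 ler_norml; apply/andP; split; lra.
(* Everything up to [n t] is filled by stage [t], so what no earlier stage fills gets the parity of
   [t]. *)
- move=> q _ qN nb; rewrite signF_iter_shift (stage_parityE hn _ nb) ?signr_odd //.
  exact: filled_small.
- exact: count_filled_before_le.
Qed.

Theorem mainTheorem3 (R : realType) (l : nat) (hl : (1 <= l)%N) :
  exists x : full_shift,
    [/\ toeplitz x,
        regular_toeplitz R x,
        ~ @almost_PNT R l full_shift (orbit_closure x) left_shift &
        exists2 n : nat -> nat, periodic_structure x n &
          ~ cvgn (fun t => @almost_prime_avg R l (n t)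
                             (fun q => signF R (iter q left_shift x)))].
Proof.
have [n hn] := sparse_sequence_exists hl.
exists (stage_parity hn); split.
- exact: toeplitz_stage_parity.
- exact: regular_stage_parity.
- move=> PNT; apply: (@not_cvgn_stage_parity R l n hn).
  have xX : orbit_closure (stage_parity hn) (stage_parity hn).
    apply: subset_closure; exists 0 => //.
    by apply/funext => a; rewrite /shiftz addr0.
  have fX : {within orbit_closure (stage_parity hn), continuous (signF R)}.
    by apply: continuous_subspaceT; exact: continuous_signF.
  have /cvg_ex[L hL] := PNT _ _ xX fX.
  apply/cvg_ex; exists L.
  (* Convergence along all [N] would pass to the subsequence [n], which tends to infinity because
     [t < n t]. *)
  apply: (cvg_comp n (fun N => almost_prime_avg l N _) _ hL).
  move=> A [N _ hA]; exists N => // t /= Nt; apply: hA => /=.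
  exact: leq_trans Nt (ltnW (sparse_gt hn t)).
- exists n; first exact: periodic_structure_stage_parity.
  exact: not_cvgn_stage_parity.
Qed.
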